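(* Let $d_1,d_2,d_3\ge 2$ and let $\rho=\rho_{d_1\otimes d_2\otimes d_3}$ be any (normalized) mixed state on $H_1\otimes H_2\otimes H_3$ with $\dim H_i=d_i$. Then $$C_3(\rho)\;\ge\;\frac{1}{\sqrt{(d_1-1)(d_2-1)(d_3-1)}}\Big[\sum_{\rho_{2\otimes2\otimes2}}\ \sum_{m=1}^{2}\sum_{n=m+1}^{3} C_{mn}^2(\rho_{2\otimes 2\otimes 2})\Big]^{1/2},$$ where the outer sum runs over all $\binom{d_1}{2}\binom{d_2}{2}\binom{d_3}{2}$ possible $2\otimes2\otimes2$ substates $\rho_{2\otimes2\otimes2}$ of $\rho$.
   Context: Each $H_i\cong\mathbb{C}^{d_i}$ has a fixed computational basis $\{|1\rangle,\dots,|d_i\rangle\}$. For a (not necessarily normalized) vector $|\varphi\rangle\in H_1\otimes\cdots\otimes H_N$ with $\sigma=|\varphi\rangle\langle\varphi|$, the $N$-partite concurrence is $C_N(|\varphi\rangle)=2^{1-N/2}\sqrt{(2^N-2)(\mathrm{tr}\,\sigma)^2-\sum_\alpha \mathrm{tr}(\sigma_\alpha^2)}$, where $\alpha$ runs over all $2^N-2$ nonempty proper subsets of $\{1,\dots,N\}$ and $\sigma_\alpha=\mathrm{tr}_{\bar\alpha}\sigma$ is the partial trace over the complement $\bar\alpha$ (for normalized states $\mathrm{tr}\,\sigma=1$). For a (possibly unnormalized) positive semidefinite operator $\sigma$, $C_N(\sigma)=\min\sum_i C_N(|\psi_i\rangle)$, the minimum over all decompositions $\sigma=\sum_i|\psi_i\rangle\langle\psi_i|$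 into (unnormalized) vectors (equivalently the convex roof $\min\sum_ip_iC_N(|\varphi_i\rangle)$ over ensembles $\sigma=\sum_ip_i|\varphi_i\rangle\langle\varphi_i|$). Substates: given subsets $S_i\subseteq\{1,\dots,d_i\}$ and projectors $G_i=\sum_{x\in S_i}|x\rangle\langle x|$, the corresponding substate of $\sigma$ is the unnormalized operator $(G_1\otimes\cdots\otimes G_N)\sigma(G_1\otimes\cdots\otimes G_N)$ regarded as an operator on $\bigotimes_i\mathrm{span}\{|x\rangle:x\in S_i\}$; a $2\otimes2\otimes2$ substate is one with $|S_1|=|S_2|=|S_3|=2$. For an (unnormalized) three-qubit operator $\tau$, $C_{mn}(\tau)$ denotes the Wootters concurrence of the two-qubit reduced operator $\tau_{mn}$ (partial trace over the remaining qubit): $C(\omega)=\max\{0,\lambda_1-\lambda_2-\lambda_3-\lambda_4\}$ where $\lambda_1\ge\dots\ge\lambda_4$ are the square roots of the eigenvalues of $\omega(\sigma_y\otimes\sigma_y)\omega^*(\sigma_y\otimes\sigma_y)$, $\omega^*$ the complex conjugate in the computational basis. *)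

(* Defs.v *)
From HB Require Import structures.
From mathcomp Require Import all_boot all_order all_algebra.
From mathcomp Require classical_sets.
From mathcomp Require Import reals.
From mathcomp Require Import complex.
Set Implicit Arguments. Unset Strict Implicit. Unset Printing Implicit Defensive.
Import Order.TTheory GRing.Theory Num.Theory.
Local Open Scope ring_scope.

Section Defs.
Variable R : realType.
Local Notation C := (R[i]).

(** Computational basis indices of H_1 (x) ... (x) H_N, dim H_i = d i. *)
Definition idx (N : nat) (d : 'I_N -> nat) := {dffun forall i : 'I_N, 'I_(d i)}.

Definition vec N (d : 'I_N -> nat) := idx d -> C.
Definition op N (d : 'I_N -> nat) := idx d -> idx d -> C.

Definition trace N (d : 'I_N -> nat) (s : op d) : C := \sum_(x : idx d) s x x.

Definition psd N (d : 'I_N -> nat) (s : op d) : Prop :=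
  (forall x y, s x y = Num.conj (s y x)) /\
  (forall v : vec d, 0 <= \sum_(x : idx d) \sum_(y : idx d) Num.conj (v x) * s x y * v y).

Definition proj N (d : 'I_N -> nat) (phi : vec d) : op d :=
  fun x y => phi x * Num.conj (phi y).

Definition ridx N (d : 'I_N -> nat) (alpha : {set 'I_N}) :=
  {dffun forall i : {i : 'I_N | i \in alpha}, 'I_(d (val i))}.

Lemma notin_setC N (alpha : {set 'I_N}) (i : 'I_N) :
  (i \in alpha) = false -> i \in ~: alpha.
Proof. by move=> h; rewrite inE h. Qed.

Definition join N (d : 'I_N -> nat) (alpha : {set 'I_N})
  (a : ridx d alpha) (b : ridx d (~: alpha)) : idx d :=
  @finfun 'I_N (fun i => 'I_(d i)) (fun i =>
    (if i \in alpha as c return (i \in alpha) = c -> 'I_(d i)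
     then fun h => a (exist _ i h)
     else fun h => b (exist _ i (notin_setC h))) (erefl _)).

Definition ptrace N (d : 'I_N -> nat) (alpha : {set 'I_N}) (s : op d) :
  ridx d alpha -> ridx d alpha -> C :=
  fun a a' => \sum_(b : ridx d (~: alpha)) s (join a b) (join a' b).

Definition trsq N (d : 'I_N -> nat) (alpha : {set 'I_N}) (s : op d) : C :=
  \sum_(a : ridx d alpha) \sum_(a' : ridx d alpha)
     ptrace s a a' * ptrace s a' a.

(** N-partite concurrence of a (not necessarily normalized) vector;
    2^(1 - N/2) = sqrt (4 / 2^N). *)
Definition conc_pure N (d : 'I_N -> nat) (phi : vec d) : R :=
  let s := proj phi in
  Num.sqrt (4 / 2 ^+ N) *
  Num.sqrt (complex.Re ((2 ^+ N - 2) * trace s ^+ 2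
               - \sum_(alpha : {set 'I_N} | (alpha != set0) && (alpha != setT))
                    trsq alpha s)).

Definition decomp N (d : 'I_N -> nat) (s : op d) (k : nat) (psi : 'I_k -> vec d) :=
  forall x y, s x y = \sum_(i < k) proj (psi i) x y.

(** convex roof (minimum = infimum over all finite decompositions) *)
Definition conc_mixed N (d : 'I_N -> nat) (s : op d) : R :=
  inf (fun r : R => exists (k : nat) (psi : 'I_k -> vec d),
                     decomp s psi /\ r = \sum_(i < k) conc_pure (psi i)).

(** two-qubit basis |ab> ordered |00>,|01>,|10>,|11>: p = 2 a + b *)
Definition hi (p : 'I_4) : 'I_2 := inord (p %/ 2).
Definition lo (p : 'I_4) : 'I_2 := inord (p %% 2).

Definition sigma_y : 'M[C]_2 :=
  \matrix_(i, j) (if i == j then 0 else if i == ord0 then - 'i%C else 'i%C).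

Definition sYY : 'M[C]_4 :=
  \matrix_(p, q) (sigma_y (hi p) (hi q) * sigma_y (lo p) (lo q)).

Definition wootters_spec (w : 'M[C]_4) (lam : {ffun 'I_4 -> R}) : Prop :=
  (forall i, 0 <= lam i) /\ (forall i j : 'I_4, (i <= j)%N -> lam j <= lam i) /\
  char_poly (w *m sYY *m map_mx Num.conj w *m sYY)
    = \prod_(i < 4) ('X - ((lam i) ^+ 2)%:C%C%:P).

Definition wootters (w : 'M[C]_4) : R :=
  let lam := classical_sets.xget [ffun=> 0] (wootters_spec w) in
  Num.max 0 (lam (inord 0) - lam (inord 1) - lam (inord 2) - lam (inord 3)).

Definition qidx := {ffun 'I_3 -> 'I_2}.

(** a choice of two basis vectors S_i = {sel i 0 < sel i 1} in each H_i *)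
Definition selection (d : 'I_3 -> nat) :=
  {dffun forall i : 'I_3, {ffun 'I_2 -> 'I_(d i)}}.

Definition emb (d : 'I_3 -> nat) (sl : selection d) (u : qidx) : idx d :=
  @finfun 'I_3 (fun i => 'I_(d i)) (fun i => sl i (u i)).

(** the substate (G1 (x) G2 (x) G3) rho (G1 (x) G2 (x) G3) on the span of S_i *)
Definition substate (d : 'I_3 -> nat) (rho : op d) (sl : selection d) :
  qidx -> qidx -> C := fun u v => rho (emb sl u) (emb sl v).

Definition qset (m n : 'I_3) (p : 'I_4) (c : 'I_2) : qidx :=
  [ffun i => if i == m then hi p else if i == n then lo p else c].

Definition red2 (tau : qidx -> qidx -> C) (m n : 'I_3) : 'M[C]_4 :=
  \matrix_(p, q) \sum_(c : 'I_2) tau (qset m n p c) (qset m n q c).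

End Defs.

(* Main.v *)
Require Import Defs.
From HB Require Import structures.
From mathcomp Require Import all_boot all_order all_algebra.
From mathcomp Require classical_sets.
From mathcomp Require Import reals.
From mathcomp Require Import complex ring.
Import Order.TTheory GRing.Theory Num.Theory.
Import ComplexField.Normc.
Local Open Scope ring_scope.

(** Write a decomposition as rho = sum_i |psi_i><psi_i|.  For a pure state phi,
[conc_pure phi ^+ 2] is a quarter of the sum, over all subsets al and all pairs
x, y of basis indices, of |phi x phi y - phi x' phi y'|^2, where x', y' are x, y
with their coordinates outside al exchanged.  A given pair (x, y) lies in at
most prod_i (d_i - 1) of the 2 x 2 x 2 substates, so the squared concurrences of
the substates of phi sum to at most prod_i (d_i - 1) * [conc_pure phi ^+ 2].  For
three qubits, [conc_pure phi ^+ 2] equals sum_(m<n) ||T_mn||^2, with T_mn the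
2 x 2 matrix of the spin-flip form on the two components of phi along the
remaining qubit, and ||.|| the Frobenius norm.

It remains to bound the Wootters concurrence of rho_mn by sum_i ||T_mn(psi_i)||.
If rho_mn = V V^* then the Wootters lambda_j are the nonzero singular values of
the symmetric matrix T = V^T sYY V.  Its Takagi factorization
T = sum_j lambda_j w_j^T w_j, with orthonormal rows w_j, and the triangle
inequality on the diagonal blocks T_mn(psi_i) give
sum_i ||T_mn(psi_i)|| >= lambda_1 - lambda_2 - lambda_3 - lambda_4.
Minkowski's inequality adds these bounds up over all m < n and all substates. *)

Set Implicit Arguments.
Unset Strict Implicit.
Unset Printing Implicit Defensive.

Local Open Scope sesquilinear_scope.

(** * Takagi factorization of complex symmetric matrices *)

(** Both sides are ['X^n] times the determinant of the block matrix with rows (X, A) and (B, 1),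
    made block triangular by column operations in [e1] and by row operations in [e2]. *)
Lemma char_poly_mulmxC (F : comNzRingType) m n (A : 'M[F]_(m, n)) (B : 'M[F]_(n, m)) :
  'X^n * char_poly (A *m B) = 'X^m * char_poly (B *m A).
Proof.
pose a := map_mx (@polyC F) A; pose b := map_mx (@polyC F) B.
have e1 : block_mx 'X%:M a b 1%:M *m block_mx 1%:M 0 (- b) 1%:M
        = block_mx ('X%:M - a *m b) a 0 1%:M :> 'M_(m + n).
  by rewrite mulmx_block !(mulmx0, mul0mx, mulmx1, mul1mx, add0r, addr0) mulmxN subrr.
have e2 : block_mx 1%:M 0 (- b) 'X%:M *m block_mx 'X%:M a b 1%:M
        = block_mx 'X%:M a 0 ('X%:M - b *m a) :> 'M_(m + n).
  rewrite mulmx_block !(mulmx0, mul0mx, mulmx1, mul1mx, add0r, addr0) !mulNmx.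
  by rewrite mul_scalar_mx mul_mx_scalar addNr addrC.
have := congr1 (fun M => 'X^n * \det M) e1; rewrite /= det_mulmx det_ublock det_lblock.
have := congr1 determinant e2; rewrite det_mulmx det_ublock det_lblock.
rewrite !det1 !mulr1 !mul1r !det_scalar => ->.
by rewrite /char_poly /char_poly_mx !map_mxM => /= <-.
Qed.

Section Takagi.
Variable R : rcfType.
Local Notation C := R[i].
Local Notation "M ^~c" := (map_mx Num.conj M) (at level 30).

(** An eigenvector [u] of conj(T) T has eigenvalue [mu >= 0], because symmetry of [T] gives |u
    conj(T)|^2 = mu |u|^2. With s the root of [mu], the vector conj(u) T + s u is then a
    coneigenvector for s. *)
Lemma coneigenvector n (T : 'M[C]_n.+1) : T^T = T ->
  exists s : R, exists2 w : 'rV[C]_n.+1, 0 <= s /\ w != 0 & w^~c *m T = s%:C%C *: w.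
Proof.
move=> Tsym.
have [//|mu] := @eigenvalue_closed C n.+1 (T^~c *m T).
case/eigenvalueP => u uE u0.
have mu0 : 0 <= mu.
  have dz p (v : 'rV[C]_p) : 0 <= dotmx v v.
    have [->|/dotmx_is_dotmx/ltW //] := eqVneq v 0.
    by rewrite dotmxE mul0mx mxE.
  have : dotmx (u *m T^~c) (u *m T^~c) = mu * dotmx u u.
    rewrite !dotmxE trmx_mul map_trmx Tsym map_mxM -map_mx_comp.
    rewrite (map_mx_id (@conjCK _)) !mulmxA -[_ *m _ *m T]mulmxA uE.
    by rewrite -scalemxAl mxE.
  by have := dz _ (u *m T^~c) => /[swap] ->; rewrite pmulr_lge0 ?dotmx_is_dotmx.
have s0 : 0 <= sqrtC mu by rewrite sqrtC_ge0.
have sE : (complex.Re (sqrtC mu))%:C%C = sqrtC mu by rewrite RRe_real // ger0_real.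
exists (complex.Re (sqrtC mu)); rewrite sE.
have Re0 : 0 <= complex.Re (sqrtC mu) by rewrite -ler0c sE.
have conjs : (sqrtC mu)^* = sqrtC mu by apply/CrealP; rewrite ger0_real.
have conjK p q (M : 'M[C]_(p, q)) : M^~c^~c = M.
  by rewrite -map_mx_comp (map_mx_id (@conjCK _)).
(* [w] is a coneigenvector unless it vanishes, and then ['i *: u] is one. *)
pose w := (u *m T^~c)^~c + sqrtC mu *: u.
have [w0|w0] := eqVneq w 0; last first.
  exists w => //; rewrite /w map_mxD conjK map_mxZ /= conjs mulmxDl -mulmxA uE.
  rewrite map_mxM conjK -scalemxAl scalerDr scalerA -expr2 sqrtCK addrC //.
exists ('i *: u).
  by split=> //; rewrite scaler_eq0 negb_or u0 neq0Ci.
move/eqP: w0; rewrite /w map_mxM conjK addr_eq0 => /eqP h.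
by rewrite map_mxZ /= conjCi -scalemxAl h scaleNr scalerN opprK !scalerA mulrC.
Qed.

(** Gram-Schmidt applied to the matrix with all rows equal to [w] normalizes the first row and
    completes it to a unitary matrix. The factor [c] has to be real because the coneigenvector
    equation does not survive a general complex rescaling. *)
Lemma unitary_extension n (w : 'rV[C]_n.+1) : w != 0 ->
  exists2 Q : 'M[C]_n.+1, Q \is unitarymx &
    exists2 c : C, 0 < c & w = c *: row ord0 Q.
Proof.
move=> w0; pose A : 'M[C]_n.+1 := \matrix_(i, j) w 0 j.
have rA : row ord0 A = w by apply/rowP=> j; rewrite !mxE.
exists (schmidt A); first exact: schmidt_unitarymx.
have := form1_row_schmidt A ord0; have := row_schmidt_sub A ord0.
rewrite (big_pred1 ord0) ?genmxE => [|k]; last by rewrite leqn0.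
case/sub_rVP=> c; rewrite rA => wE; rewrite wE => h; exists c => //.
have /unitarymxP /matrixP /(_ ord0 ord0) := @schmidt_unitarymx C n.+1 n.+1 A (leqnn _).
have -> : forall M : 'M[C]_n.+1, (M *m M^t*) ord0 ord0 = dotmx (row ord0 M) (row ord0 M).
  by move=> M; rewrite dotmxE !mxE; apply: eq_bigr => i _; rewrite !mxE.
rewrite mxE eqxx => e; move: h; rewrite dotmxE -scalemxAl mxE -dotmxE e mulr1.
rewrite le_eqVlt => /predU1P[c0|//]; case/eqP: w0.
by rewrite wE -c0 scale0r.
Qed.

Lemma unitarymx_conj_tr n (Q : 'M[C]_n) : Q \is unitarymx -> Q^~c *m Q^T = 1%:M.
Proof.
move=> /unitarymxP /(congr1 (map_mx Num.conj)).
by rewrite map_mxM -map_mx_comp (map_mx_id (@conjCK _)) map_mx1.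
Qed.

(** Induction on the size. For a unitary [Q] whose first row is a coneigenvector, [S] is symmetric
    with first row (s, 0, ..., 0), hence block diagonal, and the induction hypothesis applies to its
    lower right block. *)
Theorem takagi n (T : 'M[C]_n) : T^T = T ->
  exists d : 'I_n -> R, exists2 Q : 'M[C]_n, Q \is unitarymx &
    (forall i, 0 <= d i) /\ T = Q^T *m diag_mx (\row_i (d i)%:C%C) *m Q.
Proof.
elim: n => [|n IHn] in T * => Tsym.
  exists (fun=> 0); exists 1%:M; first by apply/unitarymxP; rewrite trmx1 map_mx1 mulmx1.
  by split=> [[]//|]; rewrite [LHS]flatmx0 [RHS]flatmx0.
have [s [w [s0 w0] wE]] := coneigenvector Tsym.
have [Q Qu [c c0 {}wE']] := unitary_extension w0.
pose q := row ord0 Q.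
have qE : q^~c *m T = s%:C%C *: q.
  have c1 : c^* = c by apply/CrealP; rewrite gtr0_real.
  move: wE; rewrite wE' map_mxZ /= c1 -scalemxAl scalerA mulrC -scalerA.
  by move/(scalerI (lt0r_neq0 c0)).
have QcV := unitarymx_conj_tr Qu.
have QTc : Q^T *m Q^~c = 1%:M by apply: mulmx1C.
have QV : Q^t* *m Q = 1%:M by apply: mulmx1C; apply/unitarymxP.
pose S : 'M[C]_(1 + n) := Q^~c *m T *m Q^t*.
have TS : T = Q^T *m S *m Q.
  by rewrite /S !mulmxA QTc mul1mx -mulmxA QV mulmx1.
have Ssym : S^T = S.
  by rewrite /S !trmx_mul Tsym !map_trmx !trmxK mulmxA.
have ul : ulsubmx S = s%:C%C%:M /\ ursubmx S = 0.
  have r0 : usubmx S = s%:C%C *: row_mx 1%:M 0.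
    have -> : usubmx S = row ord0 S.
      by apply/rowP=> j; rewrite !mxE; apply: eq_bigr => k _; rewrite !mxE; congr (_ * _);
         apply: eq_bigr => l _; rewrite !mxE; congr (((Q _ _)^*) * _); apply: val_inj.
    rewrite /S !row_mul -map_row qE -scalemxAl; congr (_ *: _).
    rewrite -row_mul; have /unitarymxP -> := Qu.
    by apply/rowP=> j; rewrite !mxE; case: splitP => k kE; rewrite !mxE -val_eqE /= kE ?ord1.
  rewrite -{1}[S]vsubmxK; split.
    rewrite /ulsubmx r0 -[lsubmx (usubmx _)]/(lsubmx _) col_mxKu.
    by rewrite linearZ /= row_mxKl scalemx1.
  by rewrite /ursubmx r0 linearZ /= row_mxKr scaler0.
have [ulE urE] := ul.
have dlE : dlsubmx S = 0.
  by rewrite -Ssym -trmx_ursub urE trmx0.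
have drS : (drsubmx S)^T = drsubmx S by rewrite trmx_drsub Ssym.
have [d [P Pu [d0 PE]]] := IHn _ drS.
exists (fun i => if unlift ord0 i is Some j then d j else s).
pose B : 'M[C]_(1 + n) := block_mx 1%:M 0 0 P.
have Bu : B \is unitarymx.
  apply/unitarymxP; rewrite /B tr_block_mx map_block_mx mulmx_block.
  rewrite !trmx0 !map_mx0 trmx1 map_mx1.
  rewrite !(mulmx1, mul1mx, mulmx0, mul0mx, addr0, add0r).
  by rewrite (unitarymxP Pu) -scalar_mx_block.
have SE : S = B^T *m block_mx s%:C%C%:M 0 0 (diag_mx (\row_i (d i)%:C%C)) *m B.
  rewrite -[S]submxK ulE urE dlE PE /B tr_block_mx !trmx0 trmx1 !mulmx_block.
  by rewrite !(mulmx1, mul1mx, mulmx0, mul0mx, addr0, add0r).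
exists (B *m Q).
  exact: (mul_unitarymx Bu Qu).
split=> [i|]; first by case: unliftP.
rewrite {1}TS SE trmx_mul.
have -> : diag_mx (\row_(i < n.+1) (if unlift ord0 i is Some j then d j else s)%:C%C) =
   block_mx s%:C%C%:M 0 0 (diag_mx (\row_i (d i)%:C%C)) :> 'M_(1 + n).
  apply/matrixP => i j; rewrite !mxE.
  case: splitP => i' iE; rewrite !mxE; case: splitP => j' jE; rewrite !mxE.
  - have -> : i = ord0 by apply: val_inj; rewrite /= iE ord1.
    have -> : j = ord0 by apply: val_inj; rewrite /= jE ord1.
    by rewrite unlift_none !ord1.
  - by rewrite -val_eqE /= iE jE ord1.
  - by rewrite -val_eqE /= iE jE ord1.
  - have -> : i = lift ord0 i' by apply: val_inj; rewrite /= iE.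
    have -> : j = lift ord0 j' by apply: val_inj; rewrite /= jE.
    by rewrite liftK (inj_eq (@lift_inj _ _)).
by rewrite !mulmxA.
Qed.

End Takagi.

(** * Bounding the Wootters concurrence *)

Section Minkowski.
Variable R : rcfType.

(** Lagrange's identity: the sum of all (a_i b_j - a_j b_i)^2 is twice the gap between the two
    squared sides. *)
Lemma cauchy_schwarz_sum (I : finType) (P : pred I) (a b : I -> R) :
  \sum_(i | P i) a i * b i
    <= Num.sqrt (\sum_(i | P i) a i ^+ 2) * Num.sqrt (\sum_(i | P i) b i ^+ 2).
Proof.
have sq0 (h : I -> R) : 0 <= \sum_(i | P i) h i ^+ 2.
  by apply: sumr_ge0 => i _; apply: sqr_ge0.
rewrite -sqrtrM //; set s := \sum_(i | P i) a i * b i.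
rewrite (le_trans (ler_norm s)) // -sqrtr_sqr ler_wsqrtr // -subr_ge0.
have : 0 <= \sum_(i | P i) \sum_(j | P j) (a i * b j - a j * b i) ^+ 2.
  by apply: sumr_ge0 => i _; apply: sq0.
suff -> : \sum_(i | P i) \sum_(j | P j) (a i * b j - a j * b i) ^+ 2
   = 2 * ((\sum_(i | P i) a i ^+ 2) * (\sum_(i | P i) b i ^+ 2) - s ^+ 2).
  by rewrite pmulr_rge0 // ltr0n.
under eq_bigr => i _.
  under eq_bigr => j _.
    have -> : (a i * b j - a j * b i) ^+ 2 =
      a i ^+ 2 * b j ^+ 2 + a j ^+ 2 * b i ^+ 2 - 2 * (a i * b i) * (a j * b j) by ring.
    over.
  rewrite !big_split /= sumrN -!mulr_sumr -mulr_suml.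
  over.
rewrite !big_split /= sumrN -!mulr_suml -!mulr_sumr.
by rewrite -/s; ring.
Qed.

(** By duality: with N the norm of [W], N^2 = <W, W> <= sum_i <W, f_i> <= N sum_i |f_i|. Assuming
    only an upper bound on [W] lets it be a concurrence or the modulus of a matrix entry. *)
Lemma minkowski_sum (S I : finType) (P : pred S) (Q : pred I) (W : S -> R) (f : I -> S -> R) :
  (forall s, P s -> 0 <= W s <= \sum_(i | Q i) f i s) ->
  Num.sqrt (\sum_(s | P s) W s ^+ 2)
    <= \sum_(i | Q i) Num.sqrt (\sum_(s | P s) f i s ^+ 2).
Proof.
move=> Wf; set N := Num.sqrt _.
have NE : N ^+ 2 = \sum_(s | P s) W s ^+ 2.
  by rewrite sqr_sqrtr // sumr_ge0 // => s _; apply: sqr_ge0.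
have [->|N0] := eqVneq N 0; first by rewrite sumr_ge0 // => i _; apply: sqrtr_ge0.
have {}N0 : 0 < N by rewrite lt_def N0 sqrtr_ge0.
rewrite -(ler_pM2l N0) -expr2 NE mulr_sumr.
have le1 : \sum_(s | P s) W s ^+ 2 <= \sum_(s | P s) \sum_(i | Q i) W s * f i s.
  apply: ler_sum => s Ps; have /andP[W0 Wle] := Wf s Ps.
  by rewrite -mulr_sumr expr2 ler_wpM2l.
rewrite (le_trans le1) // exchange_big /= ler_sum // => i _.
exact: cauchy_schwarz_sum.
Qed.

End Minkowski.

Section WoottersBound.
Variable R : realType.
Local Notation C := R[i].
Local Notation "M ^~c" := (map_mx Num.conj M) (at level 30).

Lemma sYYE p q : sYY R p q = sigma_y R (hi p) (hi q) * sigma_y R (lo p) (lo q).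
Proof. by rewrite [LHS]mxE. Qed.

(** [sigma_y] is purely imaginary, and the two signs cancel in its tensor square. *)
Lemma sYY_conj : (sYY R) ^~c = sYY R.
Proof.
apply/matrixP => p q; rewrite [LHS]mxE !sYYE rmorphM.
have conjs (a b : 'I_2) : (sigma_y R a b)^* = - sigma_y R a b.
  rewrite !mxE; case: ifP => _; first by rewrite rmorph0 oppr0.
  case: ifP => _; rewrite complexiE ?rmorphN /= conjCi ?opprK //.
by rewrite /= !conjs mulrNN.
Qed.

Lemma sYY_sym : (sYY R)^T = sYY R.
Proof.
apply/matrixP => p q; rewrite [LHS]mxE !sYYE.
have sy (a b : 'I_2) : sigma_y R a b = - sigma_y R b a.
  rewrite !mxE eq_sym; case: eqVneq => [|ab]; first by rewrite oppr0.
  by case: a b ab => [[|[|//]] ?] [[|[|//]] ?]; rewrite -?val_eqE //= ?opprK.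
by rewrite sy [X in _ * X = _]sy mulrNN.
Qed.

(** conj(T) T is unitarily similar to the square of the diagonal factor, so the [d i] are the
    singular values of [T]. *)
Lemma takagi_char_poly n (d : 'I_n -> R) (Q T : 'M[C]_n) :
  Q \is unitarymx -> T = Q^T *m diag_mx (\row_i (d i)%:C%C) *m Q ->
  char_poly (T ^~c *m T) = \prod_(i < n) ('X - ((d i)%:C%C ^+ 2)%:P).
Proof.
move=> Qu TE.
have QcV := unitarymx_conj_tr Qu.
set D := diag_mx _ in TE.
have Dc : D ^~c = D.
  rewrite map_diag_mx; congr diag_mx; apply/rowP => j; rewrite !mxE.
  by apply/CrealP; apply/complex_realP; exists (d j).
have -> : T ^~c *m T = Q^t* *m (D *m D *m Q).
  have -> : T ^~c = Q^t* *m D *m Q ^~c by rewrite TE !map_mxM Dc.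
  rewrite [X in _ *m X]TE.
  have assoc (A B E F G : 'M[C]_n) : E *m F = 1%:M ->
      A *m B *m E *m (F *m B *m G) = A *m (B *m B *m G).
    by move=> EF; rewrite -!mulmxA (mulmxA E) EF mul1mx.
  exact: assoc.
have nz : ('X^n : {poly C}) != 0 by rewrite monic_neq0 ?monicXn.
apply: (mulfI nz); rewrite char_poly_mulmxC; congr (_ * _).
rewrite mulmxtVK // char_poly_trig; last by rewrite mulmx_diag diag_mx_is_trig.
by apply: eq_bigr => i _; rewrite mulmx_diag !mxE eqxx mulr1n expr2.
Qed.

(** The columns of [V] decompose the two-qubit operator, and [gr] records which columns stem from
    the same pure state; the right side sums the Frobenius norms of the corresponding diagonal
    blocks of [T]. *)
Lemma wootters_le K (G : finType) (gr : 'I_K -> G) (V : 'M[C]_(4, K)) :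
  wootters (V *m V^t*)
  <= \sum_(g : G) Num.sqrt (\sum_(a : 'I_K * 'I_K | (gr a.1 == g) && (gr a.2 == g))
                     normc ((V^T *m sYY R *m V) a.1 a.2) ^+ 2).
Proof.
have [T Tdef] : exists T, T = V^T *m sYY R *m V by eexists.
rewrite -Tdef.
have rhs0 : 0 <= \sum_(g : G) Num.sqrt (\sum_(a : 'I_K * 'I_K | (gr a.1 == g) && (gr a.2 == g))
                     normc (T a.1 a.2) ^+ 2).
  by apply: sumr_ge0 => g _; apply: sqrtr_ge0.
(* If no [lam] meets [wootters_spec], [xget] returns the zero function and the concurrence is 0. *)
rewrite /wootters /=; case: classical_sets.xgetP => [lam _ [lam0 [lamle lamE]]|_]; last first.
  by rewrite !ffunE !subr0 maxxx.
rewrite ge_max rhs0 /=.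
have Tsym : T^T = T by rewrite Tdef !trmx_mul trmxK sYY_sym mulmxA.
have [d [Q Qu [d0 TE]]] := takagi Tsym.
(* The Wootters matrix is [V] times a matrix whose product with [V] in the other order is conj(T) T.
   The powers of X make up for the sizes 4 and [K]. *)
have : 'X^4 * \prod_(i < K) ('X - ((d i)%:C%C ^+ 2)%:P)
     = 'X^K * \prod_(i < 4) ('X - ((lam i)%:C%C ^+ 2)%:P) :> {poly C}.
  rewrite -(takagi_char_poly Qu TE); under [in RHS]eq_bigr do rewrite -rmorphXn.
  rewrite -lamE.
  have -> : V *m V^t* *m sYY R *m (V *m V^t*) ^~c *m sYY R
     = V *m (T ^~c *m V^T *m sYY R).
    by rewrite Tdef !map_mxM -map_mx_comp (map_mx_id (@conjCK _)) sYY_conj !mulmxA.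
  rewrite (char_poly_mulmxC V).
  by rewrite -(mulmxA _ V^T) -(mulmxA _ (V^T *m _)) -Tdef.
have prodE n (e : 'I_n -> R) m : 'X^m * \prod_(i < n) ('X - ((e i)%:C%C ^+ 2)%:P)
  = \prod_(x <- nseq m 0 ++ [seq (e i)%:C%C ^+ 2 | i : 'I_n]) ('X - x%:P) :> {poly C}.
  by rewrite big_cat /= big_nseq polyC0 subr0 big_image /= iter_mulr mulr1.
rewrite !prodE => /prod_XsubC_eq.
(* The zero-padded lists of squares are permutations of each other; square roots recover [d] and
   [lam] themselves, as both are nonnegative. *)
move/(perm_map (fun z => complex.Re (sqrtC z))).
have mapE n (e : 'I_n -> R) m : (forall i, 0 <= e i) ->
  [seq complex.Re (sqrtC z) | z <- nseq m 0 ++ [seq (e i)%:C%C ^+ 2 | i : 'I_n]]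
   = nseq m 0 ++ [seq e i | i : 'I_n].
  move=> e0; rewrite map_cat map_nseq sqrtC0; congr (_ ++ _).
  rewrite -map_comp; apply: eq_map => i /=.
  by rewrite sqrCK // ler0c.
rewrite !mapE // => perm.
have sumE : \sum_i d i = \sum_i lam i.
  have : \sum_(x <- nseq 4 0 ++ [seq d i | i : 'I_K]) x
       = \sum_(x <- nseq K 0 ++ [seq lam i | i : 'I_4]) x by apply: perm_big.
  by rewrite !big_cat !big_nseq !iter_addr !mul0rn /= !addr0 !add0r !big_image.
(* In this form only the largest value and the total enter, and both can be read off [d] despite the
   zero padding. *)
have lamS : lam (inord 0) - lam (inord 1) - lam (inord 2) - lam (inord 3) =
   2 * lam (inord 0) - \sum_i lam i.
  rewrite !big_ord_recl big_ord0.
  have lamI (i : 'I_4) k : i = k :> nat -> lam i = lam (inord k).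
    by move=> <-; rewrite inord_val.
  rewrite (lamI ord0 0)// (lamI (lift ord0 ord0) 1)//.
  rewrite (lamI (lift ord0 (lift ord0 ord0)) 2)//.
  by rewrite (lamI (lift ord0 (lift ord0 (lift ord0 ord0))) 3)//; ring.
rewrite lamS -sumE.
(* A largest value 0 might come only from the padding and have no index in [d]; the left side is
   then at most 0. *)
have [l0|l0] := eqVneq (lam (inord 0)) 0.
  by rewrite l0 mulr0 sub0r (le_trans _ rhs0) // oppr_le0 sumr_ge0.
have [i0 di0] : exists i0, lam (inord 0) = d i0.
  have : lam (inord 0) \in nseq 4 0 ++ [seq d i | i : 'I_K].
    by rewrite (perm_mem perm) mem_cat image_f ?orbT.
  rewrite mem_cat mem_nseq (negPf l0) /= => /imageP[i _ ->]; by exists i.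
rewrite di0 (bigD1 i0) //= opprD addrA [2 * _]mulr_natl mulr2n addrK lerBlDr.
have rowQ i : \sum_a normc (Q i a) ^+ 2 = 1.
  have /unitarymxP /matrixP /(_ i i) := Qu; rewrite !mxE eqxx mulr1n => /(congr1 (@complex.Re R)).
  move=> /= <-; rewrite raddf_sum; apply: eq_bigr => a _.
  rewrite !mxE -normCK; case: (Q i a) => x y; rewrite normc_def -rmorphXn /=.
  by [].
pose gs g i := \sum_(a | gr a == g) normc (Q i a) ^+ 2.
have gsE i : \sum_g gs g i = 1.
  rewrite -(rowQ i) (partition_big gr xpredT) //=.
have main g : d i0 * gs g i0 <=
   Num.sqrt (\sum_(a : 'I_K * 'I_K | (gr a.1 == g) && (gr a.2 == g)) normc (T a.1 a.2) ^+ 2)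
   + \sum_(i < K | i != i0) d i * gs g i.
  (* [d i * gs g i] is the Frobenius norm of the block at [g] of the rank-one Takagi term of index
     [i]. For fixed [i] the weights [gs g i] add up to 1 over all [g]. *)
  have gsq i : d i * gs g i = Num.sqrt
    (\sum_(a : 'I_K * 'I_K | (gr a.1 == g) && (gr a.2 == g))
        (d i * normc (Q i a.1) * normc (Q i a.2)) ^+ 2).
    rewrite -[LHS]ger0_norm; last first.
      by rewrite mulr_ge0 // sumr_ge0 // => a _; apply: sqr_ge0.
    rewrite -sqrtr_sqr; congr Num.sqrt.
    rewrite exprMn [gs g i ^+ 2]expr2 /gs big_distrlr /= pair_big /= mulr_sumr.
    by apply: eq_bigr => -[a b] _ /=; rewrite !exprMn; ring.
  (* The slot [i0] holds [T] itself, since the term [i0] is [T] minus all the other terms. *)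
  pose f i (a : 'I_K * 'I_K) := if i == i0 then normc (T a.1 a.2)
       else d i * normc (Q i a.1) * normc (Q i a.2).
  rewrite gsq (le_trans (minkowski_sum (Q := xpredT) (f := f) _)) //.
    move=> [a b] _; apply/andP; split => /=.
      by rewrite !mulr_ge0 //; case: (Q _ _) => x y; apply: sqrtr_ge0.
    have fE i : i != i0 -> f i (a, b) = d i * normc (Q i a) * normc (Q i b).
      by rewrite /f => /negPf ->.
    rewrite (bigD1 i0) //= (eq_bigr _ fE) {1}/f eqxx /=.
    have TabE : T a b = \sum_i (d i)%:C%C * Q i a * Q i b.
      rewrite TE -mulmxA !mxE; apply: eq_bigr => i _.
      by rewrite mul_diag_mx !mxE; ring.
    have nE i : (d i * normc (Q i a) * normc (Q i b))%:C%C = `|(d i)%:C%C * Q i a * Q i b|.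
      by rewrite !rmorphM !normrM [`|(d i)%:C%C|]ger0_norm ?ler0c.
    rewrite -lecR rmorphD rmorph_sum (eq_bigr _ (fun i _ => nE i)) nE.
    rewrite (bigD1 i0) //= in TabE.
    rewrite -[X in `|X|](addrK (\sum_(i < K | i != i0) (d i)%:C%C * Q i a * Q i b)) -TabE.
    by rewrite (le_trans (ler_normB _ _)) // lerD2l ler_norm_sum.
  have fE i : i != i0 ->
      Num.sqrt (\sum_(s | (gr s.1 == g) && (gr s.2 == g)) f i s ^+ 2) = d i * gs g i.
    by rewrite gsq /f => /negPf ->.
  by rewrite (bigD1 i0) //= (eq_bigr _ fE) {1}/f eqxx.
rewrite -[leLHS]mulr1 -(gsE i0) mulr_sumr.
apply: (le_trans (ler_sum _ (fun g _ => main g))).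
rewrite big_split /= lerD2l exchange_big /= ler_sum // => i _.
by rewrite -mulr_sumr gsE mulr1.
Qed.

End WoottersBound.

(** * Concurrence of pure states *)

Section Mix.
Variables (N : nat) (d : 'I_N -> nat).
Implicit Types (al : {set 'I_N}) (x y : idx d).

Definition mix al x y : idx d :=
  @finfun 'I_N (fun i => 'I_(d i)) (fun i => if i \in al then x i else y i).

Definition restr al x : ridx d al :=
  @finfun {i : 'I_N | i \in al} (fun i => 'I_(d (val i))) (fun i => x (val i)).

Lemma join_in al (a : ridx d al) (b : ridx d (~: al)) i (h : i \in al) :
  join a b i = a (exist _ i h).
Proof.
rewrite ffunE.
(* Abstracting both the boolean and its equation makes the case analysis in the dependent match well
   typed. *)
suff gen (c : bool) (e : (i \in al) = c) :
  (if c as c' return (i \in al) = c' -> 'I_(d i)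
     then fun h => a (exist _ i h)
     else fun h => b (exist _ i (notin_setC h))) e = a (exist _ i h) by exact: gen.
case: c e => e; first by congr (a (exist _ i _)); apply: bool_irrelevance.
by have := h; rewrite e.
Qed.

Lemma join_notin al (a : ridx d al) (b : ridx d (~: al)) i (h : i \in ~: al) :
  join a b i = b (exist _ i h).
Proof.
rewrite ffunE.
suff gen (c : bool) (e : (i \in al) = c) :
  (if c as c' return (i \in al) = c' -> 'I_(d i)
     then fun h => a (exist _ i h)
     else fun h => b (exist _ i (notin_setC h))) e = b (exist _ i h) by exact: gen.
case: c e => e; last by congr (b (exist _ i _)); apply: bool_irrelevance.
by have := h; rewrite inE e.
Qed.

Lemma join_restr al x : join (restr al x) (restr (~: al) x) = x.
Proof.
apply/ffunP => i; case: (boolP (i \in al)) => [h|]; first by rewrite (join_in _ _ h) ffunE.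
by rewrite -in_setC => h; rewrite (join_notin _ _ h) ffunE.
Qed.

Lemma restr_join al (a : ridx d al) (b : ridx d (~: al)) : restr al (join a b) = a.
Proof. by apply/ffunP => -[i h]; rewrite ffunE (join_in _ _ h). Qed.

Lemma restrC_join al (a : ridx d al) (b : ridx d (~: al)) : restr (~: al) (join a b) = b.
Proof. by apply/ffunP => -[i h]; rewrite ffunE (join_notin _ _ h). Qed.

Lemma mix_join al (a a' : ridx d al) (b b' : ridx d (~: al)) :
  mix al (join a b) (join a' b') = join a b'.
Proof.
apply/ffunP => i; rewrite [LHS]ffunE; case: ifP => h; first by rewrite !(join_in _ _ h).
by move/negbT: h; rewrite -in_setC => h; rewrite !(join_notin _ _ h).
Qed.

Lemma sum_join (V : nmodType) al (F : idx d -> V) :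
  \sum_x F x = \sum_(a : ridx d al) \sum_(b : ridx d (~: al)) F (join a b).
Proof.
rewrite pair_bigA /= (reindex (fun p : ridx d al * ridx d (~: al) => join p.1 p.2)) //=.
exists (fun x => (restr al x, restr (~: al) x)) => [[a b] _|x _] /=.
  by rewrite restr_join restrC_join.
by rewrite join_restr.
Qed.

Lemma mixK al x y : mix al (mix al x y) (mix al y x) = x.
Proof. by apply/ffunP => i; rewrite !ffunE; case: (i \in al). Qed.

End Mix.

Section PureConcurrence.
Variables (R : realType) (N : nat) (d : 'I_N -> nat).
Local Notation C := R[i].
Implicit Types (al : {set 'I_N}) (phi : vec R d).

(** With [phi] read as a matrix, coordinates in [al] indexing rows and the others columns, this is
    the 2 x 2 minor on the rows and columns of [x] and [y]. All of them vanish exactly for product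
    vectors across this cut. *)
Definition minor al phi (x y : idx d) : C :=
  phi x * phi y - phi (mix al x y) * phi (mix al y x).

Definition minor_energy al phi : R := \sum_x \sum_y normc (minor al phi x y) ^+ 2.

Lemma normc_sqr (z : C) : (normc z ^+ 2)%:C%C = z * z^*.
Proof. by rewrite rmorphXn -normCK. Qed.

(** On pairs of indices put A(x, y) = phi x phi y, and let the involution [S] exchange the
    coordinates outside [al]. Then (tr)^2 = <A, A> and tr(sigma_al^2) = <A, A o S>, while |A - A o
    S|^2 is twice their difference. *)
Lemma trsq_minor al phi :
  trace (proj phi) ^+ 2 - trsq al (proj phi) = (minor_energy al phi / 2)%:C%C.
Proof.
pose A (p : idx d * idx d) := phi p.1 * phi p.2.
pose S (p : idx d * idx d) := (mix al p.1 p.2, mix al p.2 p.1).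
have SK : involutive S by move=> [x y]; rewrite /S /= !mixK.
have trE : trace (proj phi) ^+ 2 = \sum_p A p * (A p)^*.
  rewrite expr2 /trace big_distrlr /= pair_bigA /=; apply: eq_bigr => p _.
  by rewrite /A /proj rmorphM /=; ring.
have trsqE : trsq al (proj phi) = \sum_p A p * (A (S p))^*.
  rewrite -(pair_bigA _ (fun x y => A (x, y) * (A (S (x, y)))^*)) /= (sum_join al).
  rewrite /trsq /ptrace.
  under eq_bigr => a _ do under eq_bigr => a' _ do rewrite big_distrlr /=.
  under [RHS]eq_bigr => a _ do under eq_bigr => b _ do rewrite (sum_join al).
  under [RHS]eq_bigr => a _ do rewrite exchange_big /=.
  apply: eq_bigr => a _; apply: eq_bigr => a' _; apply: eq_bigr => b _; apply: eq_bigr => b' _.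
  by rewrite /A /proj /= !mix_join rmorphM /=; ring.
have enE : (minor_energy al phi)%:C%C = \sum_p (A p - A (S p)) * (A p - A (S p))^*.
  rewrite /minor_energy pair_bigA rmorph_sum; apply: eq_bigr => p _ /=.
  by rewrite normc_sqr.
have e1 : \sum_p A (S p) * (A (S p))^* = \sum_p A p * (A p)^*.
  by rewrite [RHS](reindex_inj (inv_inj SK)).
have e2 : \sum_p A (S p) * (A p)^* = \sum_p A p * (A (S p))^*.
  by rewrite [RHS](reindex_inj (inv_inj SK)); apply: eq_bigr => p _; rewrite SK.
rewrite rmorphM fmorphV rmorph_nat /= enE trE trsqE.
under [in RHS]eq_bigr => p _.
  have -> : (A p - A (S p)) * (A p - A (S p))^* =
     A p * (A p)^* + A (S p) * (A (S p))^* - A p * (A (S p))^* - A (S p) * (A p)^*.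
    by rewrite rmorphB /=; ring.
  over.
by rewrite !big_split /= !sumrN e1 e2; field.
Qed.

Lemma minor0 phi x y : minor set0 phi x y = 0.
Proof.
have m0 (u v : idx d) : mix set0 u v = v by apply/ffunP => i; rewrite ffunE inE.
by rewrite /minor !m0 mulrC subrr.
Qed.

Lemma minorT phi x y : minor setT phi x y = 0.
Proof.
have m0 (u v : idx d) : mix setT u v = u by apply/ffunP => i; rewrite ffunE inE.
by rewrite /minor !m0 subrr.
Qed.

Lemma minor_energy_ge0 al phi : 0 <= minor_energy al phi.
Proof. by rewrite sumr_ge0 // => x _; apply: sumr_ge0 => y _; apply: sqr_ge0. Qed.

End PureConcurrence.

(** The six copies of (tr)^2 are shared out among the nonempty proper subsets. The empty and the
    full set have zero minors and may join the sum. The constant is 4/8 times the 1/2 of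
    [trsq_minor]. *)
Lemma conc_pureE (R : realType) (d : 'I_3 -> nat) (phi : vec R d) :
  conc_pure phi = Num.sqrt ((\sum_(al : {set 'I_3}) minor_energy al phi) / 4).
Proof.
rewrite /conc_pure /=.
have set0T : (set0 : {set 'I_3}) != setT.
  by apply/eqP => /setP /(_ ord0); rewrite !inE.
have -> : (2 ^+ 3 - 2) * trace (proj phi) ^+ 2 -
    \sum_(al : {set 'I_3} | (al != set0) && (al != setT)) trsq al (proj phi)
  = ((\sum_(al : {set 'I_3}) minor_energy al phi) / 2)%:C%C.
  transitivity (\sum_(al : {set 'I_3} | (al != set0) && (al != setT))
      (trace (proj phi) ^+ 2 - trsq al (proj phi))).
    rewrite sumrB; congr (_ - _).
    have : \sum_(al : {set 'I_3}) trace (proj phi) ^+ 2 = 8 * trace (proj phi) ^+ 2.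
      by rewrite sumr_const -cardsT -powersetT card_powerset cardsT card_ord mulr_natl.
    rewrite (bigD1 set0) //= (bigD1 setT) 1?eq_sym //= => e.
    apply: (addrI (trace (proj phi) ^+ 2)); apply: (addrI (trace (proj phi) ^+ 2)).
    by rewrite e; ring.
  rewrite [in RHS](bigD1 set0) //= [in RHS](bigD1 setT) 1?eq_sym //=.
  have -> : minor_energy set0 phi = 0.
    rewrite /minor_energy big1 // => x _; rewrite big1 // => y _.
    by rewrite minor0 normc0 expr0n.
  have -> : minor_energy setT phi = 0.
    rewrite /minor_energy big1 // => x _; rewrite big1 // => y _.
    by rewrite minorT normc0 expr0n.
  rewrite !add0r mulr_suml rmorph_sum; apply: eq_bigr => al _; exact: trsq_minor.
rewrite /= -sqrtrM; last by rewrite divr_ge0 // exprn_ge0.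
by congr Num.sqrt; field.
Qed.

(** * Counting substates *)

Lemma ord2P (b : 'I_2) : b = ord0 \/ b = ord_max.
Proof.
by case: b => [[|[|//]] ?]; [left|right]; apply: val_inj.
Qed.

Section Counting.
Variables (R : realDomainType) (d : 'I_3 -> nat).

Definition flip (u : qidx) : qidx := [ffun i => rev_ord (u i)].

Definition ordered (sl : selection d) :=
  [forall i, (val (sl i ord0) < val (sl i ord_max))%N].

(** If [a] and [b] differed, the two increasing pairs would list the same values in opposite
    orders. *)
Lemma ordered_pair_inj p (f g : {ffun 'I_2 -> 'I_p}) (a b : 'I_2) :
  (val (f ord0) < val (f ord_max))%N -> (val (g ord0) < val (g ord_max))%N ->
  f a = g b -> f (rev_ord a) = g (rev_ord b) -> a = b /\ f = g.
Proof.
have r0 : rev_ord (ord0 : 'I_2) = ord_max by apply: val_inj.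
have r1 : rev_ord (ord_max : 'I_2) = ord0 by apply: val_inj.
case: (ord2P a) => ->; case: (ord2P b) => ->; rewrite ?r0 ?r1 => fo go e1 e2.
- by split=> //; apply/ffunP => c; case: (ord2P c) => ->.
- by move: fo; rewrite e1 e2 => /ltnW; rewrite leqNgt go.
- by move: fo; rewrite e1 e2 => /ltnW; rewrite leqNgt go.
- by split=> //; apply/ffunP => c; case: (ord2P c) => ->.
Qed.

(** In each coordinate, [u] and [flip u] exhibit both chosen basis vectors, and their order fixes
    [sl] and [u]. Then [v] follows because each [sl i] is strictly increasing. *)
Lemma emb_inj (sl sl' : selection d) (u u' v v' : qidx) : ordered sl -> ordered sl' ->
  emb sl u = emb sl' u' -> emb sl v = emb sl' v' -> emb sl (flip u) = emb sl' (flip u') ->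
  [/\ sl = sl', u = u' & v = v'].
Proof.
move=> /forallP slo /forallP slo' eu ev ef.
have embE (s : selection d) (w : qidx) i : emb s w i = s i (w i) by rewrite ffunE.
have key i : u i = u' i /\ sl i = sl' i.
  apply: ordered_pair_inj; rewrite ?slo ?slo' //.
    by rewrite -!embE eu.
  by have := congr1 (fun x : idx d => x i) ef; rewrite !embE !ffunE.
have eqs : sl = sl' by apply/ffunP => i; case: (key i).
split=> //; first by apply/ffunP => i; case: (key i).
apply/ffunP => i; have := congr1 (fun x : idx d => x i) ev; rewrite !embE -eqs.
have := slo i; case: (ord2P (v i)) => ->; case: (ord2P (v' i)) => -> // + e.
  by rewrite e ltnn.
by rewrite e ltnn.
Qed.

Lemma card_avoiding (x : idx d) :
  #|[set z : idx d | [forall i, z i != x i]]| = (\prod_(i < 3) (d i).-1)%N.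
Proof.
rewrite (_ : [set z | _] = setXn (fun i => [set~ x i])); last first.
  apply/setP => z; rewrite !inE; apply: eq_forallb => i; rewrite !inE //.
by rewrite cardsXn; apply: eq_bigr => i _; rewrite cardsC1 card_ord.
Qed.

(* The triple [(emb sl u, emb sl v, emb sl (flip u))] determines [(sl, u, v)], and
   its third entry differs from the first in every coordinate. *)
Lemma sum_substates (F : idx d -> idx d -> R) : (forall x y, 0 <= F x y) ->
  \sum_(sl : selection d | ordered sl)
     \sum_(u : qidx) \sum_(v : qidx) F (emb sl u) (emb sl v)
  <= (\prod_(i < 3) ((d i).-1)%:R) * \sum_(x : idx d) \sum_(y : idx d) F x y.
Proof.
move=> F0.
rewrite pair_big_dep /= pair_big_dep /=.
pose h (p : selection d * qidx * qidx) : idx d * idx d * idx d :=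
  (emb p.1.1 p.1.2, emb p.1.1 p.2, emb p.1.1 (flip p.1.2)).
pose A := [set p : selection d * qidx * qidx | ordered p.1.1].
have hinj : {in A &, injective h}.
  move=> [[s u] v] [[s' u'] v']; rewrite !inE /= => so so' [eu ev ef].
  by have [-> -> ->] := emb_inj so so' eu ev ef.
pose B := [set q : idx d * idx d * idx d | [forall i, q.2 i != q.1.1 i]].
have hAB : h @: A \subset B.
  apply/subsetP => _ /imsetP[[[s u] v] + ->]; rewrite !inE /= => /forallP so.
  apply/forallP => i; rewrite !ffunE.
  have r0 : rev_ord (ord0 : 'I_2) = ord_max by apply: val_inj.
  have r1 : rev_ord (ord_max : 'I_2) = ord0 by apply: val_inj.
  have := so i; case: (ord2P (u i)) => ->;
    by rewrite ?r0 ?r1 -val_eqE neq_ltn => ->; rewrite ?orbT.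
have -> : \sum_(p : selection d * qidx * qidx | ordered p.1.1 && true && true)
    F (emb p.1.1 p.1.2) (emb p.1.1 p.2)
   = \sum_(q in h @: A) F q.1.1 q.1.2.
  rewrite big_imset //=; apply: eq_bigl => p; by rewrite inE !andbT.
(* Passing from the image to [B] only adds nonnegative terms; in [B] each (x, y) occurs once for
   every z that differs from x in all coordinates. *)
apply: (@le_trans _ _ (\sum_(q in B) F q.1.1 q.1.2)).
  rewrite [leRHS](big_setID (h @: A)) /= (setIidPr hAB) lerDl.
  by apply: sumr_ge0.
rewrite -natr_prod pair_bigA mulr_sumr /=.
have -> : \sum_(q in B) F q.1.1 q.1.2 =
   \sum_(p : idx d * idx d) \sum_(z | z \in [set z : idx d | [forall i, z i != p.1 i]]) F p.1 p.2.
  by rewrite pair_big_dep /=; apply: eq_bigl => q; rewrite !inE.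
by apply: ler_sum => p _; rewrite sumr_const card_avoiding mulr_natl.
Qed.

End Counting.

(** * Three qubits *)

Definition triple T (a b c : T) : {ffun 'I_3 -> T} :=
  [ffun i : 'I_3 => if val i == 0%N then a else if val i == 1%N then b else c].

Local Notation o1 := (lift ord0 ord0 : 'I_3).
Local Notation o2 := (lift ord0 (lift ord0 ord0) : 'I_3).

Lemma ord3P (i : 'I_3) : [\/ i = ord0, i = o1 | i = o2].
Proof.
by case: i => [[|[|[|//]]] h]; [constructor 1|constructor 2|constructor 3]; apply: val_inj.
Qed.

Lemma sum_triple (T : finType) (V : nmodType) (F : {ffun 'I_3 -> T} -> V) :
  \sum_f F f = \sum_a \sum_b \sum_c F (triple a b c).
Proof.
under [RHS]eq_bigr do rewrite pair_bigA /=.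
rewrite pair_bigA /= (reindex (fun p : T * (T * T) => triple p.1 p.2.1 p.2.2)) //=.
exists (fun f : {ffun 'I_3 -> T} => (f ord0, (f o1, f o2))) => [[a [b c]] _|f _].
  by rewrite !ffunE.
by apply/ffunP => i; rewrite ffunE; case: (ord3P i) => ->.
Qed.

Lemma sum_pairs3 (V : nmodType) (F : 'I_3 -> 'I_3 -> V) :
  \sum_(m : 'I_3) \sum_(n : 'I_3 | (m < n)%N) F m n = F ord0 o1 + F ord0 o2 + F o1 o2.
Proof.
under eq_bigr do rewrite big_mkcond /=.
by rewrite !big_ord_recl !big_ord0 /= !addr0 !add0r.
Qed.

Lemma sum_set3 (V : nmodType) (G : {set 'I_3} -> V) :
  \sum_al G al = \sum_(a : bool) \sum_(b : bool) \sum_(c : bool) G [set i | triple a b c i].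
Proof.
rewrite -(sum_triple (fun f => G [set i | f i])).
rewrite (reindex (fun f : {ffun 'I_3 -> bool} => [set i | f i])) //=.
exists (fun A : {set 'I_3} => [ffun i => i \in A]) => [f _|A _].
  by apply/ffunP => i; rewrite ffunE inE.
by apply/setP => i; rewrite inE ffunE.
Qed.

Definition qmix (al : {set 'I_3}) (u v : qidx) : qidx :=
  [ffun i => if i \in al then u i else v i].

Lemma emb_qmix (d : 'I_3 -> nat) (sl : selection d) al u v :
  emb sl (qmix al u v) = mix al (emb sl u) (emb sl v).
Proof. by apply/ffunP => i; rewrite !ffunE; case: (i \in al). Qed.

Lemma qmix_triple (b1 b2 b3 : bool) (x y z x' y' z' : 'I_2) :
  qmix [set i | triple b1 b2 b3 i] (triple x y z) (triple x' y' z')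
  = triple (if b1 then x else x') (if b2 then y else y') (if b3 then z else z').
Proof. by apply/ffunP => i; rewrite !ffunE !inE !ffunE; case: (ord3P i) => ->. Qed.

Lemma sum_ord2 (V : nmodType) (F : 'I_2 -> V) : \sum_i F i = F ord0 + F ord_max.
Proof. by rewrite !big_ord_recl big_ord0 addr0; congr (_ + F _); apply: val_inj. Qed.

Lemma sum_hilo (V : nmodType) (F : 'I_2 -> 'I_2 -> V) :
  \sum_(p : 'I_4) F (hi p) (lo p) = \sum_a \sum_b F a b.
Proof.
rewrite pair_bigA /= (reindex (fun p : 'I_2 * 'I_2 => inord (2 * p.1 + p.2) : 'I_4)) /=; last first.
  exists (fun p : 'I_4 => (hi p, lo p)) => [[a b] _|p _].
    by congr (_, _); apply: val_inj; case: (ord2P a) => ->; case: (ord2P b) => ->; rewrite /= !inordK.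
  by apply: val_inj; case: p => [[|[|[|[|//]]]] h]; rewrite /= !inordK.
apply: eq_bigr => -[a b] _ /=.
by congr F; apply: val_inj; case: (ord2P a) => ->; case: (ord2P b) => ->; rewrite /= !inordK.
Qed.

Section QubitIdentity.
Variable R : realType.
Local Notation C := R[i].

Lemma sigma_yM (a a' b b' : 'I_2) : sigma_y R a a' * sigma_y R b b' =
  if (a == a') || (b == b') then 0 else if a == b then -1 else 1.
Proof.
rewrite !mxE.
have [_|aa] := eqVneq a a'; first by rewrite mul0r.
have [_|bb] := eqVneq b b'; first by rewrite mulr0.
have ii : 'i%C * 'i%C = -1 :> C by rewrite -expr2 sqr_i.
by case: (ord2P a) => ->; case: (ord2P b) => ->; rewrite /= ?mulrNN ?mulrN ?mulNr ii ?opprK.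
Qed.

(** [sYY] is antidiagonal with entries -1, 1, 1, -1, so only opposite basis states are paired. *)
Lemma sYY_sum (f g : 'I_2 -> 'I_2 -> C) :
  \sum_(p : 'I_4) \sum_(q : 'I_4) f (hi p) (lo p) * sYY R p q * g (hi q) (lo q)
  = f ord0 ord_max * g ord_max ord0 + f ord_max ord0 * g ord0 ord_max
  - f ord0 ord0 * g ord_max ord_max - f ord_max ord_max * g ord0 ord0.
Proof.
under eq_bigr => p _.
  under eq_bigr => q _ do rewrite sYYE sigma_yM.
  rewrite (sum_hilo (fun a b => f (hi p) (lo p) *
     (if (hi p == a) || (lo p == b) then 0 else if hi p == lo p then -1 else 1) * g a b)).
  over.
rewrite (sum_hilo (fun a' b' => \sum_a \sum_b f a' b' *
     (if (a' == a) || (b' == b) then 0 else if a' == b' then -1 else 1) * g a b)).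
by rewrite !sum_ord2 /=; ring.
Qed.

(** The entry (c, c') of T_mn, where c and c' are values of the remaining qubit. The form is
    bilinear: neither argument is conjugated. *)
Definition spinflip (t : qidx -> C) (m n : 'I_3) (c c' : 'I_2) : C :=
  \sum_(p : 'I_4) \sum_(q : 'I_4) t (qset m n p c) * sYY R p q * t (qset m n q c').

Definition qminor_energy (t : qidx -> C) (al : {set 'I_3}) : R :=
  \sum_u \sum_v normc (t u * t v - t (qmix al u v) * t (qmix al v u)) ^+ 2.

(** For a unit vector, |T_mn|^2 = 1 - tr(rho_m^2) - tr(rho_n^2) + tr(rho_mn^2), and the last term is
    the purity of the third qubit; the three pairs add up to 3 minus the three purities. The proof
    checks the identity by expansion in coordinates. *)
Lemma qubit_identity (t : qidx -> C) :
  \sum_(m : 'I_3) \sum_(n : 'I_3 | (m < n)%N) \sum_c \sum_c' normc (spinflip t m n c c') ^+ 2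
  = (\sum_al qminor_energy t al) / 4.
Proof.
have sum3 (F : 'I_2 -> 'I_2 -> 'I_2 -> C) : \sum_a \sum_b \sum_c F a b c =
    F ord0 ord0 ord0 + F ord0 ord0 ord_max + F ord0 ord_max ord0 + F ord0 ord_max ord_max
  + F ord_max ord0 ord0 + F ord_max ord0 ord_max + F ord_max ord_max ord0 + F ord_max ord_max ord_max.
  by rewrite !sum_ord2 !addrA.
pose T a b c := t (triple a b c).
have enE b1 b2 b3 : (qminor_energy t [set i | triple b1 b2 b3 i])%:C%C =
  \sum_x \sum_y \sum_z \sum_x' \sum_y' \sum_z'
    (T x y z * T x' y' z'
       - T (if b1 then x else x') (if b2 then y else y') (if b3 then z else z')
       * T (if b1 then x' else x) (if b2 then y' else y) (if b3 then z' else z)) *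
    ((T x y z)^* * (T x' y' z')^*
       - (T (if b1 then x else x') (if b2 then y else y') (if b3 then z else z'))^*
       * (T (if b1 then x' else x) (if b2 then y' else y) (if b3 then z' else z))^*).
  rewrite /qminor_energy rmorph_sum sum_triple.
  do 3 (apply: eq_bigr => ? _); rewrite rmorph_sum sum_triple.
  do 3 (apply: eq_bigr => ? _).
  by rewrite /= !qmix_triple normc_sqr /T rmorphB !rmorphM.
have qs01 p c : qset ord0 o1 p c = triple (hi p) (lo p) c.
  by apply/ffunP => i; rewrite !ffunE; case: (ord3P i) => ->.
have qs02 p c : qset ord0 o2 p c = triple (hi p) c (lo p).
  by apply/ffunP => i; rewrite !ffunE; case: (ord3P i) => ->.
have qs12 p c : qset o1 o2 p c = triple c (hi p) (lo p).
  by apply/ffunP => i; rewrite !ffunE; case: (ord3P i) => ->.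
have sf01 c c' : spinflip t ord0 o1 c c' =
    T ord0 ord_max c * T ord_max ord0 c'
  + T ord_max ord0 c * T ord0 ord_max c'
  - T ord0 ord0 c * T ord_max ord_max c' - T ord_max ord_max c * T ord0 ord0 c'.
  rewrite -(sYY_sum (fun a b => T a b c) (fun a b => T a b c')).
  by apply: eq_bigr => p _; apply: eq_bigr => q _; rewrite !qs01.
have sf02 c c' : spinflip t ord0 o2 c c' =
    T ord0 c ord_max * T ord_max c' ord0
  + T ord_max c ord0 * T ord0 c' ord_max
  - T ord0 c ord0 * T ord_max c' ord_max - T ord_max c ord_max * T ord0 c' ord0.
  rewrite -(sYY_sum (fun a b => T a c b) (fun a b => T a c' b)).
  by apply: eq_bigr => p _; apply: eq_bigr => q _; rewrite !qs02.
have sf12 c c' : spinflip t o1 o2 c c' =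
    T c ord0 ord_max * T c' ord_max ord0
  + T c ord_max ord0 * T c' ord0 ord_max
  - T c ord0 ord0 * T c' ord_max ord_max - T c ord_max ord_max * T c' ord0 ord0.
  rewrite -(sYY_sum (fun a b => T c a b) (fun a b => T c' a b)).
  by apply: eq_bigr => p _; apply: eq_bigr => q _; rewrite !qs12.
apply: complexI; rewrite sum_pairs3 sum_set3 !big_bool /=.
rewrite rmorphM fmorphV rmorph_nat !rmorphD /=.
have nE m n : (\sum_c \sum_c' normc (spinflip t m n c c') ^+ 2)%:C%C =
   \sum_c \sum_c' spinflip t m n c c' * (spinflip t m n c c')^*.
  rewrite rmorph_sum; apply: eq_bigr => c _; rewrite rmorph_sum; apply: eq_bigr => c' _.
  exact: normc_sqr.
rewrite !nE !sum_ord2 !sf01 !sf02 !sf12 !(rmorphB, rmorphD, rmorphM) /=.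
rewrite !enE !sum3 /=.
clear nE enE qs01 qs02 qs12 sf01 sf02 sf12.
(* The eight amplitudes and their conjugates become independent variables, which leaves a polynomial
   identity. *)
move: (T ord0 ord0 ord0) (T ord0 ord0 ord_max) (T ord0 ord_max ord0) (T ord0 ord_max ord_max)
 (T ord_max ord0 ord0) (T ord_max ord0 ord_max) (T ord_max ord_max ord0) (T ord_max ord_max ord_max).
clear T t => a0 a1 a2 a3 a4 a5 a6 a7.
move: (Num.conj a0) (Num.conj a1) (Num.conj a2) (Num.conj a3)
  (Num.conj a4) (Num.conj a5) (Num.conj a6) (Num.conj a7) => b0 b1 b2 b3 b4 b5 b6 b7.
by field.
Qed.
End QubitIdentity.

(** * Pure-state decompositions of positive semidefinite operators *)

Lemma psd_decomp (R : realType) N (d : 'I_N -> nat) (s : op R d) :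
  psd s -> exists k (psi : 'I_k -> vec R d), decomp s psi.
Proof.
move=> [sherm spos].
pose n := #|{: idx d}|.
pose M : 'M[R[i]]_n := \matrix_(i, j) s (enum_val i) (enum_val j).
have Mh : M \is hermsymmx.
  by apply/is_hermitianmxP; rewrite expr0 scale1r; apply/matrixP => i j; rewrite !mxE -sherm.
have Mn := hermitian_normalmx Mh.
have := orthomx_spectralP Mn.
have := spectral_unitarymx M.
set P := spectralmx M; set D := spectral_diag M => Pu.
rewrite invmx_unitary // => ME.
have D0 k : 0 <= D 0 k.
  have := spos (fun x => (P k (enum_rank x))^*).
  suff -> : \sum_x \sum_y ((P k (enum_rank x))^*)^* * s x y * (P k (enum_rank y))^* = D 0 k by [].
  transitivity ((P *m M *m P^t*) k k).
    rewrite -mulmxA !mxE (reindex (@enum_val _ (idx d))) /=; last first.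
      by apply: onW_bij; apply: enum_val_bij.
    apply: eq_bigr => i _; rewrite !mxE mulr_sumr.
    rewrite (reindex (@enum_val _ (idx d))) /=; last first.
      by apply: onW_bij; apply: enum_val_bij.
    by apply: eq_bigr => j _; rewrite !mxE !enum_valK conjCK mulrA.
  rewrite ME !mulmxA (unitarymxP Pu) mul1mx mulmxtVK //.
  by rewrite !mxE eqxx.
(* As M = P^* D P, the eigenvectors are the conjugated rows of [P]; each is scaled by the root of
   its eigenvalue, nonnegative by [D0]. *)
exists n, (fun k x => sqrtC (D 0 k) * (P k (enum_rank x))^*) => x y.
have -> : s x y = M (enum_rank x) (enum_rank y) by rewrite mxE !enum_rankK.
rewrite ME -mulmxA !mxE; apply: eq_bigr => k _.
rewrite mul_diag_mx !mxE /proj rmorphM /= conjCK.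
have -> : (sqrtC (D 0 k))^* = sqrtC (D 0 k).
  by apply/CrealP; rewrite ger0_real // sqrtC_ge0.
by rewrite -[in LHS](sqrtCK (D 0 k)) /=; ring.
Qed.

(** * From substates of pure states to the convex roof *)

Section Assembly.
Variables (R : realType) (d : 'I_3 -> nat).
Local Notation C := R[i].
Implicit Types (sl : selection d) (phi : vec R d).

Definition pair_norm sl phi (m n : 'I_3) : R := Num.sqrt
  (\sum_c \sum_c' normc (spinflip (fun u => phi (emb sl u)) m n c c') ^+ 2).

(** Tracing out the remaining qubit turns each [psi i] into two columns of [V], one per basis value
    [c]. Grouped by [i], the diagonal blocks of V^T sYY V are the matrices T_mn of the substates of
    [psi i]. *)
Lemma wootters_substate_le (rho : op R d) k (psi : 'I_k -> vec R d) sl m n :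
  decomp rho psi ->
  wootters (red2 (substate rho sl) m n) <= \sum_(i < k) pair_norm sl (psi i) m n.
Proof.
move=> dec; pose J := ('I_k * 'I_2)%type; pose er (j : J) := enum_rank j.
pose t i u := psi i (emb sl u).
pose V : 'M[C]_(4, #|{: J}|) :=
  \matrix_(p, a) t (enum_val a).1 (qset m n p (enum_val a).2).
have VE p j : V p (er j) = t j.1 (qset m n p j.2) by rewrite mxE enum_rankK.
have erb : {on xpredT, bijective er} by apply: onW_bij; apply: enum_rank_bij.
have -> : red2 (substate rho sl) m n = V *m (map_mx Num.conj V^T).
  apply/matrixP => p q; rewrite !mxE (reindex er) //=.
  under [LHS]eq_bigr => c _ do rewrite /substate dec.
  rewrite exchange_big pair_bigA /=; apply: eq_bigr => j _.
  by rewrite ![in RHS]mxE !enum_rankK.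
apply: (le_trans (wootters_le (fun a => (enum_val a).1) V)).
apply: ler_sum => i _; rewrite ler_wsqrtr //.
rewrite pair_bigA /= (reindex_onto (fun c : 'I_2 * 'I_2 => (er (i, c.1), er (i, c.2)))
   (fun a => ((enum_val a.1).2, (enum_val a.2).2))) /=; last first.
  move=> [a b] /= /andP[/eqP <- /eqP e]; rewrite -!surjective_pairing.
  by rewrite -{1}e -surjective_pairing /er !enum_valK.
rewrite (eq_bigl xpredT) => [|[c c']]; last by rewrite /= !enum_rankK /= !eqxx.
rewrite le_eqVlt; apply/orP; left; apply/eqP.
apply: eq_bigr => -[c c'] _ /=; congr (normc _ ^+ 2).
rewrite mxE /spinflip exchange_big /=; apply: eq_bigr => q _.
rewrite mxE mulr_suml; apply: eq_bigr => p _.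
by rewrite [V^T _ _]mxE !VE.
Qed.

(** By [qubit_identity] each substate contributes a quarter of its minor energies. Its minors are
    minors of [phi] at embedded indices, so [sum_substates] applies for every [al]. *)
Lemma sum_pair_norm phi :
  \sum_(sl | ordered sl) \sum_(m : 'I_3) \sum_(n : 'I_3 | (m < n)%N) pair_norm sl phi m n ^+ 2
  <= (\prod_(i < 3) ((d i).-1)%:R) * conc_pure phi ^+ 2.
Proof.
have E0 : 0 <= (\sum_(al : {set 'I_3}) minor_energy al phi) / 4.
  by rewrite divr_ge0 // sumr_ge0 // => al _; apply: minor_energy_ge0.
rewrite conc_pureE sqr_sqrtr // mulrA.
rewrite (eq_bigr (fun sl => (\sum_al qminor_energy (fun u => phi (emb sl u)) al) / 4)).
  rewrite -mulr_suml ler_wpM2r ?invr_ge0 // exchange_big mulr_sumr.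
  apply: ler_sum => al _.
  apply: le_trans (sum_substates (F := fun x y => normc (minor al phi x y) ^+ 2) _).
    rewrite le_eqVlt; apply/orP; left; apply/eqP.
    apply: eq_bigr => sl _; apply: eq_bigr => u _; apply: eq_bigr => v _.
    by rewrite !emb_qmix.
  by move=> x y; apply: sqr_ge0.
move=> sl _; rewrite -qubit_identity.
apply: eq_bigr => m _; apply: eq_bigr => n _; rewrite sqr_sqrtr //.
by do 2 (apply: sumr_ge0 => ? _); apply: sqr_ge0.
Qed.

End Assembly.

Unset Implicit Arguments.

Theorem theorem1 (R : realType) (d : 'I_3 -> nat) (rho : op R d) :
  (forall i, (2 <= d i)%N) ->
  psd rho -> trace rho = 1 ->
  (Num.sqrt (\prod_(i < 3) ((d i).-1)%:R))^-1 *
    Num.sqrt (\sum_(sl : selection d | [forall i, (val (sl i ord0) < val (sl i ord_max))%N])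
                \sum_(m : 'I_3) \sum_(n : 'I_3 | (m < n)%N)
                   wootters (red2 (substate rho sl) m n) ^+ 2)
  <= conc_mixed rho.
Proof.
(* The infimum runs over a nonempty set by [psd_decomp], so it suffices to bound the value of every
   single decomposition. *)
move=> d2 rho_psd _; apply: lb_le_inf.
  by have [k [psi dec]] := psd_decomp rho_psd; exists (\sum_(i < k) conc_pure (psi i)), k, psi.
move=> _ [k [psi [dec ->]]].
have D0 : 0 < \prod_(i < 3) ((d i).-1)%:R :> R.
  by apply: prodr_gt0 => i _; rewrite ltr0n -ltnS prednK // ltnW.
rewrite mulrC ler_pdivrMr ?sqrtr_gt0 // mulr_suml.
(* One sum over triples (sl, m, n) lets a single use of Minkowski's inequality cover all substates
   and qubit pairs. *)
rewrite pair_big_dep /= pair_big_dep /=.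
apply: le_trans (minkowski_sum (Q := xpredT)
  (f := fun i s => pair_norm s.1.1 (psi i) s.1.2 s.2) _) _ => [s _|].
  by rewrite wootters_substate_le // andbT /wootters le_max lexx.
apply: ler_sum => i _; rewrite -[conc_pure _]ger0_norm; last first.
  by rewrite conc_pureE sqrtr_ge0.
rewrite -sqrtr_sqr -sqrtrM ?sqr_ge0 // mulrC ler_wsqrtr //.
apply: le_trans (sum_pair_norm (psi i)).
by rewrite pair_big_dep /= pair_big_dep.
Qed.
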